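(* Let $\epsilon\in\{-1,0,1\}$ and assume $\alpha_0>2\eta_0$ (equivalently $C_0^2<\tfrac12$ with $C_0:=(\eta_0/\alpha_0)^{1/2}$). Then there exists $C_{\mathrm{sta}}>0$, depending only on $C_0$ (hence independent of $h$, of the contrast $\kappa_{\max}/\kappa_{\min}$, and of $C_T$), such that $$a_h^{(\epsilon)}(v_h,v_h)\ge C_{\mathrm{sta}}\,|\!|\!|v_h|\!|\!|^2\qquad\forall v_h\in V_h.$$
   Context: Setting. Let $\Omega\subset\mathbb R^d$, $d\in\{2,3\}$, be a bounded polyhedral Lipschitz domain. Let $\kappa:\Omega\to\mathbb R^{d\times d}$ be symmetric with $\kappa_{\min}|\xi|^2\le\xi^\top\kappa(x)\xi\le\kappa_{\max}|\xi|^2$ for all $\xi\in\mathbb R^d$ and a.e. $x$, where $0<\kappa_{\min}\le\kappa_{\max}<\infty$. Let $\mathcal T_h$ be a conforming affine simplicial mesh of $\Omega$ from a shape-regular family, with $h_E=\operatorname{diam}E$, $h=\max_Eh_E\le1$, and assume $\kappa$ is constant on each element, $\kappa_E:=\kappa|_E$. $\mathcal F_h=\mathcal F_h^i\cup\mathcal F_h^b$ is the set of faces (edges if $d=2$), split into interior and boundary faces; $\mathcal F_E$ is the set of faces of $E$, $n_{E,F}$ the unit outward normal to $F\in\mathcal F_E$, and $\eta_0:=\max_E\#\mathcal F_E$. For an interior face $F=\partial E_1\cap\partial E_2$, a subscript $i\in\{1,2\}$ denotes the trace from $E_i$ and $n_i:=n_{E_i,F}$. $\nabla_h$ is the elementwise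 gradient; $(\cdot,\cdot)_{\mathcal T_h}:=\sum_E(\cdot,\cdot)_{L^2(E)}$, $\langle\cdot,\cdot\rangle_{\mathcal F}:=\sum_{F\in\mathcal F}\langle\cdot,\cdot\rangle_{L^2(F)}$ for a set $\mathcal F$ of faces; $H^2(\mathcal T_h)$ is the broken Sobolev space. Fix $k\ge1$: $V_h:=\{v\in L^2(\Omega):v|_E\in\mathbb P_k(E)\ \forall E\}$. Trace operators. For an interior face and a pair of weights $(\omega_1,\omega_2)$ with $\omega_1+\omega_2=1$ (boundary faces: $(1,0)$): $[\varphi]:=\varphi_1n_1+\varphi_2n_2$, $\{\varphi\}^*_\omega:=\omega_2\varphi_1+\omega_1\varphi_2$; on a boundary face $F\subset\partial E$: $[\varphi]:=\varphi|_En_{E,F}$, $\{\varphi\}^*_\omega:=\varphi|_E$. Means of vector fields are componentwise; for a vector field $\mathbf b$, $[\mathbf b]:=\mathbf b_1\cdot n_1+\mathbf b_2\cdot n_2$ (scalar) on interior faces. Penalty and coefficients. Let $C_T>0$ be such that $\|w\|_{L^2(F)}^2\le C_T^2h_E^{-1}\|w\|_{L^2(E)}^2$ for all $E$, $F\in\mathcal F_E$, $w\in\mathbb P_k(E)$. Fix $\alpha_0>0$ and set $\tau|_{E,F}:=\alpha_0C_T^2\kappa_{E,F}h_E^{-1}$ with $\kappa_{E,F}:=n_{E,F}^\top\kappa_En_{E,F}$. On an interior face with $\tau_i:=\tau|_{E_i,F}$: $\omega^\tau_i:=\tau_i/(\tau_1+\tau_2)$, $\varrho_0:=\tau_1\tau_2/(\tau_1+\tau_2)$,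 $\varrho_1:=1/(\tau_1+\tau_2)$; on a boundary face $F\subset\partial E$: $\omega^\tau:=(1,0)$, $\varrho_0:=\tau|_{E,F}$. UIP-DG method. For $u,v$ with $u|_E,v|_E\in H^2(E)$ for all $E$: $a_h^{(\epsilon)}(u,v):=(\kappa\nabla_hu,\nabla_hv)_{\mathcal T_h}+a^c_h(u,v)+\epsilon\,a^c_h(v,u)+s^{(\epsilon)}_h(u,v)$, where $a^c_h(u,v):=-\langle\{\kappa\nabla_hu\}^*_{\omega^\tau},[v]\rangle_{\mathcal F_h}$ and $s_h^{(\epsilon)}(u,v):=\langle\varrho_0[u],[v]\rangle_{\mathcal F_h}-\epsilon\langle\varrho_1[\kappa\nabla_hu],[\kappa\nabla_hv]\rangle_{\mathcal F_h^i}$. Norms. $|v|_{0,h}^2:=\sum_{F\in\mathcal F_h}\|\varrho_0^{1/2}[v]\|_{L^2(F)}^2$, $|\!|\!|v|\!|\!|^2:=\sum_E\|\kappa^{1/2}\nabla v\|_{L^2(E)}^2+|v|_{0,h}^2$. *)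

(* Defs.v *)
From HB Require Import structures.
From mathcomp Require Import all_boot all_order all_algebra.
From mathcomp Require Import all_classical all_reals all_analysis.
Set Implicit Arguments. Unset Strict Implicit. Unset Printing Implicit Defensive.
Import Order.TTheory GRing.Theory Num.Theory.
Import numFieldNormedType.Exports.
Local Open Scope classical_set_scope.
Local Open Scope ring_scope.

Section Geometry.
Variable R : realType.

Definition dotv m (u v : 'rV[R]_m) : R := \sum_(i < m) u 0 i * v 0 i.
Definition enorm m (u : 'rV[R]_m) : R := Num.sqrt (dotv u u).

(* integral over the scaled reference simplex {y in R^m : y >= 0, sum y <= s},
   by iterated (Lebesgue) integrals; f takes the list of coordinates *)
Fixpoint simplex_int (m : nat) (f : seq R -> R) (s : R) : R :=
  match m with
  | 0 => f [::]
  | m'.+1 => \int[lebesgue_measure]_(t in [set` `[0, s]])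
               simplex_int m' (fun y => f (t :: y)) (s - t)
  end.

Definition conv_hull d m (P : 'I_m -> 'rV[R]_d) : set 'rV[R]_d :=
  [set x | exists l : 'I_m -> R, (forall i, 0 <= l i) /\ \sum_i l i = 1 /\
                                  x = \sum_i l i *: P i].

Definition grad d (f : 'rV[R]_d -> R) (x : 'rV[R]_d) : 'rV[R]_d :=
  \row_i derive1 (fun t : R => f (x + t *: delta_mx 0 i)) 0.

Definition is_Pk d (k : nat) (f : 'rV[R]_d -> R) : Prop :=
  exists c : {ffun 'I_d -> 'I_k.+1} -> R, forall x,
    f x = \sum_(a : {ffun 'I_d -> 'I_k.+1} | (\sum_i (a i : nat) <= k)%N)
            c a * \prod_i (x 0 i) ^+ a i.

Definition open_set d (O : set 'rV[R]_d) :=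
  forall x, O x -> exists2 r : R, 0 < r & forall y, enorm (y - x) < r -> O y.
Definition bounded_set d (O : set 'rV[R]_d) :=
  exists M : R, forall x, O x -> enorm x <= M.
Definition in_closure d (O : set 'rV[R]_d) x :=
  forall r : R, 0 < r -> exists y, O y /\ enorm (y - x) < r.
Definition lipschitz_boundary d (O : set 'rV[R]_d) :=
  forall x, in_closure O x -> ~ O x ->
    exists r : R, 0 < r /\ exists nu : 'rV[R]_d, enorm nu = 1 /\
    exists (g : 'rV[R]_d -> R) (L : R), 0 <= L /\
      (forall z z', `|g z - g z'| <= L * enorm (z - z')) /\
      (forall y, enorm (y - x) < r ->
         (O y <-> dotv (y - x) nu < g ((y - x) - dotv (y - x) nu *: nu))).
Definition lipschitz_domain d (O : set 'rV[R]_d) :=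
  [/\ open_set O, connected O, bounded_set O & lipschitz_boundary O].

Variables (n nE : nat).
Local Notation pt := 'rV[R]_n.+1.
(* element E has vertices V E i, i : 'I_n.+2 ; face j of E is the face
   opposite to vertex j, with vertices V E (lift j m), m : 'I_n.+1 *)
Variable V : 'I_nE -> 'I_n.+2 -> pt.

Definition fv (E : 'I_nE) (j : 'I_n.+2) (m : 'I_n.+1) : pt := V E (lift j m).

Definition elemB (E : 'I_nE) : 'M[R]_n.+1 :=
  \matrix_(i, c) (V E (lift ord0 i) - V E ord0) 0 c.
Definition faceM (E : 'I_nE) (j : 'I_n.+2) : 'M[R]_(n, n.+1) :=
  \matrix_(i, c) (fv E j (lift ord0 i) - fv E j ord0) 0 c.

(* integral over the element E (affine change of variables) *)
Definition int_elem (E : 'I_nE) (g : pt -> R) : R :=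
  `|\det (elemB E)| *
  simplex_int n.+1 (fun y => g (V E ord0 +
     \sum_(i < n.+1) y`_i *: (V E (lift ord0 i) - V E ord0))) 1.
(* surface integral over the face j of E: sqrt(Gram det) * reference integral *)
Definition int_face (E : 'I_nE) (j : 'I_n.+2) (g : pt -> R) : R :=
  Num.sqrt (\det (faceM E j *m (faceM E j)^T)) *
  simplex_int n (fun y => g (fv E j ord0 +
     \sum_(i < n) y`_i *: (fv E j (lift ord0 i) - fv E j ord0))) 1.

Definition diam (E : 'I_nE) : R :=
  \big[Num.max/0]_(i < n.+2) \big[Num.max/0]_(i' < n.+2) enorm (V E i - V E i').

Definition elems_nondegenerate := forall E, \det (elemB E) != 0.
Definition distinct_elems :=
  forall E E', E != E' -> exists i, forall i', V E i != V E' i'.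
(* conformity: two distinct elements intersect exactly in the convex hull
   of their common vertices (empty if none) *)
Definition conforming :=
  forall E E', E != E' ->
    conv_hull (V E) `&` conv_hull (V E') =
    [set x | exists l : 'I_n.+2 -> R, (forall i, 0 <= l i) /\ \sum_i l i = 1 /\
        (forall i, l i != 0 -> exists i', V E i = V E' i') /\
        x = \sum_i l i *: V E i].
Definition covers (O : set pt) :=
  forall x, in_closure O x <-> exists E, conv_hull (V E) x.

Definition shared E j E' j' :=
  E != E' /\ (forall m, exists m', fv E j m = fv E' j' m') /\
              (forall m', exists m, fv E j m = fv E' j' m').
(* nb E j = the neighbouring element across face j of E (interior face),
   or None (boundary face) *)
Definition neighbour_spec (nb : 'I_nE -> 'I_n.+2 -> option ('I_nE * 'I_n.+2)) :=
  forall E j, match nb E j with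
              | Some (E', j') => shared E j E' j'
              | None => forall E' j', ~ shared E j E' j'
              end.
Definition normal_spec (nrm : 'I_nE -> 'I_n.+2 -> pt) :=
  forall E j, enorm (nrm E j) = 1 /\
    (forall m m', dotv (nrm E j) (fv E j m - fv E j m') = 0) /\
    dotv (nrm E j) (V E j - fv E j ord0) < 0.
Definition kappa_spec (K : 'I_nE -> 'M[R]_n.+1) (kmin kmax : R) :=
  0 < kmin /\ kmin <= kmax /\
  forall E, (K E)^T = K E /\
    forall xi : pt, kmin * dotv xi xi <= dotv (xi *m K E) xi /\
                    dotv (xi *m K E) xi <= kmax * dotv xi xi.
Definition trace_const (k : nat) (CT : R) :=
  0 < CT /\ forall E j (w : pt -> R), is_Pk k w ->
    int_face E j (fun x => w x ^+ 2) <= CT ^+ 2 / diam E * int_elem E (fun x => w x ^+ 2).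

(* eta_0 = max number of faces of an element = n+2 = d+1 for simplices *)
Definition eta0 : R := (n.+2)%:R.

Variables (nb : 'I_nE -> 'I_n.+2 -> option ('I_nE * 'I_n.+2))
          (nrm : 'I_nE -> 'I_n.+2 -> pt) (K : 'I_nE -> 'M[R]_n.+1)
          (alpha0 CT : R).

(* broken functions: one (polynomial) piece per element *)
Local Notation bfun := ('I_nE -> pt -> R).

Definition kEF E j : R := dotv (nrm E j *m K E) (nrm E j).
Definition tau E j : R := alpha0 * CT ^+ 2 * kEF E j / diam E.

(* sum over the set of faces F_h: an interior face is seen from both of its
   elements, hence weight 1/2 *)
Definition face_sum (G : 'I_nE -> 'I_n.+2 -> R) : R :=
  \sum_E \sum_j (if nb E j is Some _ then 2^-1 else 1) * G E j.

Definition flux (u : bfun) E x : pt := grad (u E) x *m (K E)^T.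

Definition jump (v : bfun) E j x : pt :=
  match nb E j with
  | Some (E', j') => v E x *: nrm E j + v E' x *: nrm E' j'
  | None => v E x *: nrm E j
  end.
Definition wmean (u : bfun) E j x : pt :=
  match nb E j with
  | Some (E', j') =>
      let t1 := tau E j in let t2 := tau E' j' in
      (t2 / (t1 + t2)) *: flux u E x + (t1 / (t1 + t2)) *: flux u E' x
  | None => flux u E x
  end.
Definition flux_jump (u : bfun) E j x : R :=
  match nb E j with
  | Some (E', j') => dotv (flux u E x) (nrm E j) + dotv (flux u E' x) (nrm E' j')
  | None => 0
  end.
Definition rho0 E j : R :=
  match nb E j with
  | Some (E', j') => tau E j * tau E' j' / (tau E j + tau E' j')
  | None => tau E j
  end.
Definition rho1 E j : R :=
  match nb E j with
  | Some (E', j') => (tau E j + tau E' j')^-1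
  | None => 0
  end.

Definition vol_form (u v : bfun) : R :=
  \sum_E int_elem E (fun x => dotv (flux u E x) (grad (v E) x)).
Definition ac_form (u v : bfun) : R :=
  - face_sum (fun E j => int_face E j (fun x => dotv (wmean u E j x) (jump v E j x))).
Definition s_form (eps : R) (u v : bfun) : R :=
  face_sum (fun E j => int_face E j (fun x => rho0 E j * dotv (jump u E j x) (jump v E j x)))
  - eps * face_sum (fun E j => if nb E j is Some _ then
          int_face E j (fun x => rho1 E j * flux_jump u E j x * flux_jump v E j x)
        else 0).
Definition a_h (eps : R) (u v : bfun) : R :=
  vol_form u v + ac_form u v + eps * ac_form v u + s_form eps u v.

Definition jump_seminorm2 (v : bfun) : R :=
  face_sum (fun E j => int_face E j (fun x => rho0 E j * dotv (jump v E j x) (jump v E j x))).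
Definition energy_norm2 (v : bfun) : R := vol_form v v + jump_seminorm2 v.

End Geometry.
Arguments eta0 {R} n.

(* Main.v *)
(** On an interior face with fluxes [a_i] (outward normal components), jump [J]
    and penalties [t_i], completing the square in [J] and the identity
    [(w2 a1 - w1 a2)^2 / rho0 + rho1 (a1 + a2)^2 = a1^2 / t1 + a2^2 / t2]
    bound all consistency and flux-jump terms by one quantity per element side.
    Each such quantity is at most [alpha0^-1] times the energy of its element, by
    the trace inequality applied to the scalar polynomial [n . kappa grad v] and
    by Cauchy-Schwarz for [kappa]; summing over the sides produces
    [eta0 / alpha0 = C0^2 < 1/2]. The case [eps = 0] is the mean of
    [eps = 1] and [eps = -1].

    An interior face is integrated in the parametrizations of its two elements;
    these integrals agree because, for polynomials, the simplex integral is given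
    by Dirichlet's formula, symmetric in the barycentric coordinates, and because
    the Gram determinant is invariant under permutations of the vertices.
    Conformity yields that a face has at most one neighbour, on the opposite side,
    whose normal is the opposite one. *)

Require Import Defs.
From HB Require Import structures.
From mathcomp Require Import all_boot all_order all_algebra all_fingroup.
From mathcomp Require Import all_classical all_reals all_analysis.
From mathcomp Require Import ring lra.
Import Order.TTheory GRing.Theory Num.Theory.
Import numFieldNormedType.Exports.
Local Open Scope classical_set_scope.
Local Open Scope ring_scope.
Set Implicit Arguments.
Unset Strict Implicit.
Unset Printing Implicit Defensive.

(** * Integrals of polynomials over the reference simplex *)

Section SimplexIntegral.
Context {R : realType}.

Lemma Rintegral_deriv (p : {poly R}) (s : R) : 0 <= s ->
  \int[lebesgue_measure]_(t in `[0, s]) p^`().[t] = p.[s] - p.[0].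
Proof.
rewrite le_eqVlt => /predU1P[<-|s0].
  by rewrite set_itv1 /Rintegral integral_set1 subrr.
have cvg x (q : {poly R}) : q.[t] @[t --> x] --> q.[x].
  exact: continuous_horner.
rewrite /Rintegral (@continuous_FTC2 _ _ (horner p))//.
- exact/continuous_subspaceT/continuous_horner.
- split.
  + by move=> x _; exact: derivable_horner.
  + by apply: cvg_at_right_filter; exact: cvg.
  + by apply: cvg_at_left_filter; exact: cvg.
- by move=> x _; rewrite -derivE.
Qed.

Lemma deriv_surj (p : {poly R}) : exists q : {poly R}, q^`() = p.
Proof.
exists (\poly_(i < (size p).+1) (p`_i.-1 / i%:R)).
apply/polyP => i; rewrite coef_deriv coef_poly ltnS.
case: ltnP => [_|h] /=; last by rewrite mul0rn nth_default.
by rewrite -[LHS]mulr_natr divfK// pnatr_eq0.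
Qed.

(** Every polynomial has an antiderivative, so linearity follows from the fundamental theorem of
    calculus and no integrability has to be checked. *)
Lemma Rintegral_horner_sum (I : Type) (r : seq I) (c : I -> R)
    (p : I -> {poly R}) (s : R) : 0 <= s ->
  \int[lebesgue_measure]_(t in `[0, s]) (\sum_(i <- r) c i * (p i).[t]) =
  \sum_(i <- r) c i * \int[lebesgue_measure]_(t in `[0, s]) (p i).[t].
Proof.
move=> s0; have /choice[q qE] : forall i, exists q : {poly R}, q^`() = p i.
  by move=> i; exact: deriv_surj.
have -> : (fun t => \sum_(i <- r) c i * (p i).[t]) =
          horner (\sum_(i <- r) c i *: q i)^`().
  apply/funext => t; rewrite (raddf_sum (@deriv R)) horner_sum.
  by apply: eq_bigr => i _ /=; rewrite derivZ hornerZ qE.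
rewrite Rintegral_deriv// !horner_sum -sumrB.
by apply: eq_bigr => i _; rewrite !hornerZ -mulrBr -(qE i) Rintegral_deriv.
Qed.

(** Euler's Beta integral rescaled to [[0, s]]. Integration by parts trades one factor [t] for one
    more factor [s - t]. *)
Lemma Rintegral_beta (a b : nat) (s : R) : 0 <= s ->
  \int[lebesgue_measure]_(t in `[0, s]) (t ^+ a * (s - t) ^+ b) =
  a`!%:R * b`!%:R / (a + b).+1`!%:R * s ^+ (a + b).+1.
Proof.
move=> s0.
have fnz n : n`!%:R != 0 :> R by rewrite pnatr_eq0 -lt0n fact_gt0.
have dB n : ((s%:P - 'X) ^+ n.+1)^`() = - ((s%:P - 'X) ^+ n *+ n.+1).
  by rewrite deriv_exp derivB derivX derivC sub0r mulN1r /= mulNrn.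
elim: a b => [|a IH] b.
  pose p : {poly R} := - (b.+1%:R)^-1 *: (s%:P - 'X) ^+ b.+1.
  have -> : (fun t => t ^+ 0 * (s - t) ^+ b) = horner p^`().
    apply/funext => t; rewrite derivZ dB !hornerE hornerMn !hornerE.
    rewrite mulrNN -[X in _ * X]mulr_natl.
    by rewrite mulrA mulVf ?mul1r// pnatr_eq0.
  rewrite Rintegral_deriv// !hornerE subrr subr0 expr0n mulr0 factS.
  rewrite natrM; field; by rewrite fnz ?nat1r ?natr1 pnatr_eq0.
(* [p] is the boundary term of the integration by parts: the integrand is
   [(a+1)/(b+1) t^a (s-t)^(b+1) - p'], and [p] vanishes at both ends. *)
pose p : {poly R} := (b.+1%:R)^-1 *: ('X ^+ a.+1 * (s%:P - 'X) ^+ b.+1).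
pose f i : {poly R} := if i then 'X ^+ a * (s%:P - 'X) ^+ b.+1 else p^`().
pose c i : R := if i then a.+1%:R / b.+1%:R else -1.
have -> : (fun t => t ^+ a.+1 * (s - t) ^+ b) =
          (fun t => \sum_(i <- [:: true; false]) c i * (f i).[t]).
  apply/funext => t; rewrite !big_cons big_nil addr0 /= /p derivZ derivM dB.
  rewrite derivXn !hornerE /= !hornerMn !hornerE.
  rewrite -(mulr_natr (t ^+ a)) -(mulr_natr ((s - t) ^+ b)).
  rewrite !exprSr; field.
  by rewrite nat1r pnatr_eq0.
rewrite Rintegral_horner_sum// !big_cons big_nil addr0 /= Rintegral_deriv//.
under eq_Rintegral do rewrite !hornerE.
have -> : p.[s] - p.[0] = 0.
  rewrite /p !(hornerZ, hornerM, horner_exp, hornerX, hornerD, hornerN, hornerC).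
  by rewrite subrr !exprS !(mul0r, mulr0) subrr.
rewrite IH mulr0 addr0.
rewrite addSnnS (factS a) (factS b) (natrM _ a.+1) (natrM _ b.+1).
set x := s ^+ _; have := fnz (a + b.+1).+1; set y := _%:R => ynz.
move: x y ynz => x y ynz.
field.
by rewrite ynz nat1r pnatr_eq0.
Qed.

(* [p = (c, b, a)] encodes [c * lambda_0^b * prod_i lambda_(i+1)^(a i)], where
   [lambda_0 = s - sum_i y_i] and [lambda_(i+1) = y_i] are the barycentric
   coordinates on the simplex of size [s]. *)
Lemma simplex_int_dirichlet (m : nat) (r : seq (R * nat * ('I_m -> nat)))
    (s : R) : 0 <= s ->
  simplex_int m (fun y => \sum_(p <- r) p.1.1 *
     ((s - \sum_(i < m) y`_i) ^+ p.1.2 * \prod_(i < m) y`_i ^+ p.2 i)) s =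
  \sum_(p <- r) p.1.1 *
     ((p.1.2`!%:R * \prod_(i < m) (p.2 i)`!%:R)
        / (p.1.2 + \sum_(i < m) p.2 i + m)`!%:R
      * s ^+ (p.1.2 + \sum_(i < m) p.2 i + m)).
Proof.
have fnz n : n`!%:R != 0 :> R by rewrite pnatr_eq0 -lt0n fact_gt0.
elim: m r s => [|m IH] r s s0 /=.
  apply: eq_bigr => p _; rewrite !big_ord0 subr0 !mulr1 !addn0 divff//.
  by rewrite mul1r.
pose C (p : R * nat * ('I_m.+1 -> nat)) : R :=
  p.1.1 * ((p.1.2`!%:R * \prod_(i < m) (p.2 (lift ord0 i))`!%:R)
    / (p.1.2 + \sum_(i < m) p.2 (lift ord0 i) + m)`!%:R).
pose b (p : R * nat * ('I_m.+1 -> nat)) :=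
  (p.1.2 + \sum_(i < m) p.2 (lift ord0 i) + m)%N.
transitivity (\int[lebesgue_measure]_(t in `[0, s])
    \sum_(p <- r) C p * ('X ^+ p.2 ord0 * (s%:P - 'X) ^+ b p).[t]).
  apply: eq_Rintegral => t; rewrite inE/= in_itv/= => /andP[t0 ts].
  (* Freezing the first coordinate at [t] leaves an integrand of the same kind on the simplex of
     size [s - t], with the power of [t] absorbed in the coefficient. *)
  pose r' := [seq (p.1.1 * t ^+ p.2 ord0, p.1.2, p.2 \o lift ord0) | p <- r].
  have := IH r' (s - t); rewrite subr_ge0 => /(_ ts) IHr.
  rewrite (_ : (fun _ => _) = (fun y => \sum_(p <- r') p.1.1 *
     ((s - t - \sum_(i < m) y`_i) ^+ p.1.2 * \prod_(i < m) y`_i ^+ p.2 i))).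
    rewrite IHr big_map; apply: eq_bigr => p _ /=.
    rewrite !(hornerM, horner_exp, hornerX, hornerD, hornerN, hornerC) /C /b.
    ring.
  apply/funext => y; rewrite big_map; apply: eq_bigr => p _ /=.
  rewrite !big_ord_recl /= opprD addrA; ring.
rewrite Rintegral_horner_sum//; apply: eq_bigr => p _.
under eq_Rintegral do
  rewrite !(hornerM, horner_exp, hornerX, hornerD, hornerN, hornerC).
rewrite Rintegral_beta// !big_ord_recl /C /b.
set S := (\sum_(i < m) _)%N; set P := \prod_(i < m) _.
have -> : (p.1.2 + (p.2 ord0 + S) + m.+1 = (p.2 ord0 + (p.1.2 + S + m)).+1)%N.
  by rewrite addnS addnCA -!addnA.
set x := s ^+ _; have := fnz (p.2 ord0 + (p.1.2 + S + m)).+1.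
have := fnz (p.1.2 + S + m)%N.
set y := _%:R => ynz; set z := _%:R => znz.
move: x y z ynz znz => x y z ynz znz.
by field; rewrite ynz znz.
Qed.

Lemma simplex_int_ge0 (m : nat) (f : seq R -> R) (s : R) :
  (forall y, 0 <= f y) -> 0 <= simplex_int m f s.
Proof.
by elim: m f s => [|m IH] f s f0 //=; apply: Rintegral_ge0 => t _; exact: IH.
Qed.

End SimplexIntegral.

(** * Polynomial functions and their averages over simplices *)

Section PolynomialFunctions.
Context {R : realType}.

(** The coordinate functions [c] are arbitrary, so that Cartesian and barycentric coordinates are
    treated alike. Repeated terms are allowed, which makes sums and products plain list
    operations. *)
Definition polyfun {X : Type} {m : nat} (c : 'I_m -> X -> R) (f : X -> R) :=
  exists r : seq (R * ('I_m -> nat)),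
    forall x, f x = \sum_(p <- r) p.1 * \prod_i c i x ^+ p.2 i.

Section Closure.
Context {X : Type} {m : nat} {c : 'I_m -> X -> R}.

Lemma eq_polyfun f g : f =1 g -> polyfun c f -> polyfun c g.
Proof. by move=> fg [r rE]; exists r => x; rewrite -fg. Qed.

Lemma polyfun_cst a : polyfun c (fun=> a).
Proof.
exists [:: (a, fun=> 0%N)] => x.
by rewrite big_seq1 big1 ?mulr1// => i _; rewrite expr0.
Qed.

Lemma polyfun_coord i : polyfun c (c i).
Proof.
exists [:: (1, fun j => (j == i) : nat)] => x.
rewrite big_seq1 mul1r (bigD1 i)//= eqxx expr1 big1 ?mulr1// => j /negPf ->.
by rewrite expr0.
Qed.

Lemma polyfunD f g : polyfun c f -> polyfun c g -> polyfun c (fun x => f x + g x).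
Proof.
by move=> [r rE] [q qE]; exists (r ++ q) => x; rewrite big_cat rE qE.
Qed.

Lemma polyfunM f g : polyfun c f -> polyfun c g -> polyfun c (fun x => f x * g x).
Proof.
move=> [r rE] [q qE].
exists [seq (p.1 * p'.1, fun i => (p.2 i + p'.2 i)%N) | p <- r, p' <- q] => x.
rewrite rE qE big_allpairs_dep mulr_suml; apply: eq_bigr => p _.
rewrite mulr_sumr; apply: eq_bigr => p' _ /=.
rewrite mulrACA -big_split; congr (_ * _).
by apply: eq_bigr => i _; rewrite exprD.
Qed.

Lemma polyfunZ a f : polyfun c f -> polyfun c (fun x => a * f x).
Proof. exact/polyfunM/polyfun_cst. Qed.

Lemma polyfunB f g : polyfun c f -> polyfun c g -> polyfun c (fun x => f x - g x).
Proof.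
move=> cf cg; apply: eq_polyfun (polyfunD cf (polyfunZ (-1) cg)) => x.
by rewrite mulN1r.
Qed.

Lemma polyfun_sum (I : Type) (s : seq I) (f : I -> X -> R) :
  (forall i, polyfun c (f i)) -> polyfun c (fun x => \sum_(i <- s) f i x).
Proof.
move=> cf; elim: s => [|i s IH].
  by apply: eq_polyfun (polyfun_cst 0) => x; rewrite big_nil.
by apply: eq_polyfun (polyfunD (cf i) IH) => x; rewrite big_cons.
Qed.

Lemma polyfunX f n : polyfun c f -> polyfun c (fun x => f x ^+ n).
Proof.
move=> cf; elim: n => [|n IH].
  by apply: eq_polyfun (polyfun_cst 1) => x; rewrite expr0.
by apply: eq_polyfun (polyfunM cf IH) => x; rewrite exprS.
Qed.

Lemma polyfun_prod (I : Type) (s : seq I) (f : I -> X -> R) :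
  (forall i, polyfun c (f i)) -> polyfun c (fun x => \prod_(i <- s) f i x).
Proof.
move=> cf; elim: s => [|i s IH].
  by apply: eq_polyfun (polyfun_cst 1) => x; rewrite big_nil.
by apply: eq_polyfun (polyfunM (cf i) IH) => x; rewrite big_cons.
Qed.

End Closure.

Lemma polyfun_comp {X Y : Type} {m n : nat} {c : 'I_m -> X -> R}
    {e : 'I_n -> Y -> R} (h : Y -> X) f :
  (forall i, polyfun e (fun y => c i (h y))) ->
  polyfun c f -> polyfun e (fun y => f (h y)).
Proof.
move=> ch [r rE].
have : polyfun e (fun y => \sum_(p <- r) p.1 * \prod_i c i (h y) ^+ p.2 i).
  apply: polyfun_sum => p; apply/polyfunZ/polyfun_prod => i; exact: polyfunX.
by apply: eq_polyfun => y; rewrite rE.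
Qed.

End PolynomialFunctions.

Notation rv_polyfun := (polyfun (fun i (x : 'rV[_]_(_)) => x 0 i)).

(** * Barycentric coordinates and vertex permutations *)

Section SimplexAverage.
Context {R : realType}.

Definition bary (m : nat) (y : seq R) (i : 'I_m.+1) : R :=
  if unlift ord0 i is Some j then y`_j else 1 - \sum_(j < m) y`_j.

(** Not normalized: the constant [1] is sent to [1/m!]. *)
Definition simplex_avg {m d : nat} (P : 'I_m.+1 -> 'rV[R]_d)
    (g : 'rV[R]_d -> R) : R :=
  simplex_int m (fun y => g (P ord0 +
    \sum_(i < m) y`_i *: (P (lift ord0 i) - P ord0))) 1.

Lemma baryE {m d : nat} (P : 'I_m.+1 -> 'rV[R]_d) (y : seq R) :
  P ord0 + \sum_(i < m) y`_i *: (P (lift ord0 i) - P ord0) =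
  \sum_i bary y i *: P i.
Proof.
rewrite big_ord_recl {1}/bary unlift_none scalerBl scale1r -addrA.
congr (_ + _); rewrite scaler_suml -sumrN -big_split.
apply: eq_bigr => i _.
by rewrite /bary liftK scalerBr addrC.
Qed.

(** At size [1] the coordinate [lambda_0] loses its special role: the value is symmetric in the
    [m + 1] exponents. *)
Lemma simplex_int_bary {m : nat} (r : seq (R * ('I_m.+1 -> nat))) :
  simplex_int m (fun y => \sum_(p <- r) p.1 * \prod_i bary y i ^+ p.2 i) 1 =
  \sum_(p <- r) p.1 * ((\prod_i (p.2 i)`!%:R) / (\sum_i p.2 i + m)`!%:R).
Proof.
pose r' := [seq (p.1, p.2 ord0, p.2 \o lift ord0) | p <- r].
rewrite (_ : (fun _ => _) = (fun y => \sum_(p <- r') p.1.1 *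
   ((1 - \sum_(i < m) y`_i) ^+ p.1.2 * \prod_(i < m) y`_i ^+ p.2 i))).
  rewrite simplex_int_dirichlet// big_map; apply: eq_bigr => p _ /=.
  by rewrite !big_ord_recl expr1n mulr1.
apply/funext => y; rewrite big_map; apply: eq_bigr => p _ /=.
rewrite big_ord_recl {1}/bary unlift_none; congr (_ * (_ * _)).
by apply: eq_bigr => i _; rewrite /bary liftK.
Qed.

Lemma polyfun_affine {m d : nat} (P : 'I_m.+1 -> 'rV[R]_d) g :
  rv_polyfun g ->
  polyfun (fun i (l : 'I_m.+1 -> R) => l i) (fun l => g (\sum_i l i *: P i)).
Proof.
apply: polyfun_comp => i.
apply: (@eq_polyfun _ _ _ _ (fun l => \sum_j l j * P j 0 i)).
  by move=> l; rewrite summxE; apply: eq_bigr => j _; rewrite mxE.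
apply: polyfun_sum => j; apply: polyfunM; last exact: polyfun_cst.
exact: polyfun_coord.
Qed.

Context {m d : nat}.
Implicit Types (P : 'I_m.+1 -> 'rV[R]_d) (f g : 'rV[R]_d -> R).

(** One list of terms gives both the values of [f] and its integral, so identities between integrals
    reduce to list operations. *)
Lemma simplex_avgP P f : rv_polyfun f ->
  exists r : seq (R * ('I_m.+1 -> nat)),
    (forall l, f (\sum_i l i *: P i) = \sum_(p <- r) p.1 * \prod_i l i ^+ p.2 i)
    /\ simplex_avg P f =
      \sum_(p <- r) p.1 * ((\prod_i (p.2 i)`!%:R) / (\sum_i p.2 i + m)`!%:R).
Proof.
move=> /(polyfun_affine P)[r rE]; exists r; split=> //.
rewrite -simplex_int_bary /simplex_avg; congr simplex_int.
by apply/funext => y; rewrite baryE rE.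
Qed.

Lemma simplex_avg_linear P a f g : rv_polyfun f -> rv_polyfun g ->
  simplex_avg P (fun x => a * f x + g x) =
  a * simplex_avg P f + simplex_avg P g.
Proof.
move=> /(simplex_avgP P)[r [rE ->]] /(simplex_avgP P)[q [qE ->]].
pose r' := [seq (a * p.1, p.2) | p <- r] ++ q.
rewrite /simplex_avg (_ : (fun _ => _) = (fun y =>
    \sum_(p <- r') p.1 * \prod_i bary y i ^+ p.2 i)).
  rewrite simplex_int_bary big_cat big_map mulr_sumr /=; congr (_ + _).
  by apply: eq_bigr => p _; rewrite mulrA.
apply/funext => y; rewrite !baryE rE qE big_cat big_map mulr_sumr /=.
by congr (_ + _); apply: eq_bigr => p _; rewrite mulrA.
Qed.

Lemma simplex_avg_ge0 P f : (forall x, 0 <= f x) -> 0 <= simplex_avg P f.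
Proof. by move=> f0; apply: simplex_int_ge0. Qed.

Lemma simplex_avg_perm P (s : {perm 'I_m.+1}) f : rv_polyfun f ->
  simplex_avg (P \o s) f = simplex_avg P f.
Proof.
move=> /(simplex_avgP P)[r [rE ->]].
pose r' := [seq (p.1, p.2 \o s) | p <- r].
rewrite /simplex_avg (_ : (fun _ => _) = (fun y =>
    \sum_(p <- r') p.1 * \prod_i bary y i ^+ p.2 i)).
  rewrite simplex_int_bary big_map; apply: eq_bigr => p _ /=.
  congr (_ * (_ / (_ + _)`!%:R)); apply/esym; exact: (reindex_perm s).
apply/funext => y; rewrite baryE big_map.
transitivity (f (\sum_i bary y (s^-1%g i) *: P i)).
  rewrite [in RHS](reindex_perm s); congr f; apply: eq_bigr => i _ /=.
  by rewrite permK.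
rewrite (rE (fun i => bary y (s^-1%g i))); apply: eq_bigr => p _ /=.
rewrite (reindex_perm s); congr (_ * _); apply: eq_bigr => i _.
by rewrite permK.
Qed.

Definition edge_mx P : 'M[R]_(m, d) :=
  \matrix_(i, c) (P (lift ord0 i) - P ord0) 0 c.

(** Differences of permuted vertices are integer combinations of the original edges. The matrix is
    chosen before [P], so it can be reused along the powers of [s]. *)
Lemma edge_mx_perm (s : {perm 'I_m.+1}) :
  exists A : 'M[R]_m, forall P, edge_mx (P \o s) = A *m edge_mx P.
Proof.
exists (\matrix_(i, c) ((s (lift ord0 i) == lift ord0 c)%:R -
                        (s ord0 == lift ord0 c)%:R)) => P.
have key j c : (P j - P ord0) 0 c =
    \sum_k (j == lift ord0 k)%:R * (P (lift ord0 k) - P ord0) 0 c.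
  have [k ->|->] := unliftP ord0 j.
    rewrite (bigD1 k)//= eqxx mul1r big1 ?addr0// => k' kk'.
    by rewrite (inj_eq lift_inj) eq_sym (negPf kk') mul0r.
  by rewrite subrr mxE big1// => k _; rewrite (negPf (neq_lift _ _)) mul0r.
apply/matrixP => i c; rewrite !mxE.
transitivity ((P (s (lift ord0 i)) - P ord0) 0 c - (P (s ord0) - P ord0) 0 c).
  by rewrite !mxE; ring.
rewrite !key -sumrB; apply: eq_bigr => k _.
by rewrite !mxE; ring.
Qed.

Definition gram P : R := \det (edge_mx P *m (edge_mx P)^T).

(* The Gram determinant is multiplied by a constant [c] depending only on the
   permutation, and [c] is a positive root of unity as the group is finite. *)
Lemma gram_perm P (s : {perm 'I_m.+1}) : gram (P \o s) = gram P.
Proof.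
have [A AE] := edge_mx_perm s.
have cE Q : gram (Q \o s) = (\det A) ^+ 2 * gram Q.
  by rewrite /gram AE trmx_mul mulmxA -(mulmxA A) !det_mulmx det_tr; ring.
have ciE k : gram (P \o (s ^+ k)%g) = (\det A) ^+ 2 ^+ k * gram P.
  elim: k => [|k IH].
    rewrite expr0 mul1r; congr gram; apply/funext => i /=.
    by rewrite expg0 perm1.
  rewrite (_ : P \o _ = (P \o (s ^+ k)%g) \o s).
    by rewrite cE IH mulrA -exprS.
  by apply/funext => i /=; rewrite expgS permM.
have := ciE #[s]%g; rewrite expg_order (_ : P \o (1%g : {perm _}) = P); last first.
  by apply/funext => i /=; rewrite perm1.
have [g0 _|gn0] := eqVneq (gram P) 0; first by rewrite cE g0 mulr0.
rewrite -[X in X = _]mul1r => /(mulIf gn0)/esym/eqP.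
rewrite cE -(prednK (order_gt0 s)) pexpr_eq1 ?sqr_ge0// => /eqP ->.
by rewrite mul1r.
Qed.

End SimplexAverage.

(** * Mesh geometry *)

Section DotProduct.
Context {R : realType} {m : nat}.
Implicit Types (a : R) (u v w : 'rV[R]_m).

Lemma dotvC u v : dotv u v = dotv v u.
Proof. by apply: eq_bigr => i _; rewrite mulrC. Qed.

Lemma dotvDl u v w : dotv (u + v) w = dotv u w + dotv v w.
Proof. by rewrite -big_split; apply: eq_bigr => i _; rewrite mxE mulrDl. Qed.

Lemma dotvDr u v w : dotv u (v + w) = dotv u v + dotv u w.
Proof. by rewrite dotvC dotvDl !(dotvC u). Qed.

Lemma dotvZl a u v : dotv (a *: u) v = a * dotv u v.
Proof. by rewrite mulr_sumr; apply: eq_bigr => i _; rewrite mxE mulrA. Qed.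

Lemma dotvZr a u v : dotv u (a *: v) = a * dotv u v.
Proof. by rewrite dotvC dotvZl dotvC. Qed.

Lemma dotvNl u v : dotv (- u) v = - dotv u v.
Proof. by rewrite -scaleN1r dotvZl mulN1r. Qed.

Lemma dotvNr u v : dotv u (- v) = - dotv u v.
Proof. by rewrite dotvC dotvNl dotvC. Qed.

Lemma dotvBl u v w : dotv (u - v) w = dotv u w - dotv v w.
Proof. by rewrite dotvDl dotvNl. Qed.

Lemma dotvBr u v w : dotv u (v - w) = dotv u v - dotv u w.
Proof. by rewrite dotvDr dotvNr. Qed.

Lemma dotv_chasles q u v w : dotv u (v - w) = dotv u (v - q) - dotv u (w - q).
Proof. by rewrite -dotvBr opprB addrA subrK. Qed.

Lemma dotv_sumr (I : finType) u (f : I -> 'rV[R]_m) :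
  dotv u (\sum_i f i) = \sum_i dotv u (f i).
Proof.
rewrite /dotv exchange_big; apply: eq_bigr => i _.
by rewrite summxE mulr_sumr.
Qed.

Lemma dotv_ge0 u : 0 <= dotv u u.
Proof. by apply: sumr_ge0 => i _; rewrite -expr2 sqr_ge0. Qed.

Lemma dotvv_eq0 u : dotv u u = 0 -> u = 0.
Proof.
move=> uu0; apply/rowP => i; rewrite mxE; apply/eqP; rewrite -sqrf_eq0 expr2.
by apply/eqP; apply: (psumr_eq0P _ uu0) => // l _; rewrite -expr2 sqr_ge0.
Qed.

Lemma dotv0r u : dotv u 0 = 0.
Proof. by rewrite -(scale0r 0) dotvZr mul0r. Qed.

Lemma enorm1 u : enorm u = 1 -> dotv u u = 1.
Proof. by rewrite /enorm => u1; rewrite -[LHS]sqr_sqrtr ?dotv_ge0// u1 expr1n. Qed.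

Lemma dotv_affine (I : finType) u (q : 'rV[R]_m) (l : I -> R) (P : I -> 'rV[R]_m) :
  \sum_i l i = 1 ->
  dotv u (\sum_i l i *: P i - q) = \sum_i l i * dotv u (P i - q).
Proof.
move=> l1; rewrite -[q in LHS]scale1r -l1 scaler_suml -sumrB dotv_sumr.
by apply: eq_bigr => i _; rewrite -scalerBr dotvZr.
Qed.

End DotProduct.

Section MeshGeometry.
Context {R : realType} {n nE : nat} {V : 'I_nE -> 'I_n.+2 -> 'rV[R]_n.+1}.
Context {nrm : 'I_nE -> 'I_n.+2 -> 'rV[R]_n.+1}.
Context (ndV : elems_nondegenerate V) (nrmP : normal_spec V nrm).
Implicit Types (E : 'I_nE) (j : 'I_n.+2) (x w : 'rV[R]_n.+1).

(** The edges issuing from one vertex form a basis, being the rows of the invertible [elemB V E]. *)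
Lemma orthogonal_edges0 E w :
  (forall i, dotv w (V E i - V E ord0) = 0) -> w = 0.
Proof.
move=> w0; have unitE : elemB V E \in unitmx by rewrite unitmxE unitfE ndV.
have : elemB V E *m w^T = 0.
  apply/matrixP => i c; rewrite !mxE (ord1 c) -[RHS](w0 (lift ord0 i)).
  by apply: eq_bigr => k _; rewrite !mxE mulrC.
by move=> /(congr1 (mulmx (invmx (elemB V E))));
  rewrite mulKmx// mulmx0 => /(congr1 trmx); rewrite trmxK trmx0.
Qed.

(** The point is arbitrary, so coordinates may be negative; it will be a vertex of the neighbouring
    element. *)
Lemma barycentric_coordinates E x :
  exists l : 'I_n.+2 -> R, \sum_i l i = 1 /\ x = \sum_i l i *: V E i.
Proof.
have unitE : elemB V E \in unitmx by rewrite unitmxE unitfE ndV.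
pose c := (x - V E ord0) *m invmx (elemB V E).
pose l i := if unlift ord0 i is Some k then c 0 k else 1 - \sum_k c 0 k.
have l0 : l ord0 = 1 - \sum_k c 0 k by rewrite /l unlift_none.
have lS k : l (lift ord0 k) = c 0 k by rewrite /l liftK.
exists l; split.
  rewrite big_ord_recl l0 (eq_bigr _ (fun k _ => lS k)).
  by rewrite subrK.
rewrite big_ord_recl l0 scalerBl scale1r -addrA -[LHS](subrK (V E ord0)) addrC.
congr (_ + _); rewrite -[LHS](mulmxKV unitE) -/c mulmx_sum_row scaler_suml -sumrN.
rewrite -big_split; apply: eq_bigr => k _ /=.
rewrite lS addrC -scalerBr; congr (_ *: _).
by apply/rowP => i; rewrite !mxE.
Qed.

Lemma normal_sqr E j : dotv (nrm E j) (nrm E j) = 1.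
Proof. by have [/enorm1] := nrmP E j. Qed.

Lemma normal_orth E j i m : i != j -> dotv (nrm E j) (V E i - fv V E j m) = 0.
Proof.
have [k ->|->] := unliftP j i; last by rewrite eqxx.
by move=> _; have [_ [fo _]] := nrmP E j; exact: fo.
Qed.

Lemma normal_lt0 E j m : dotv (nrm E j) (V E j - fv V E j m) < 0.
Proof.
have [_ [fo lt0]] := nrmP E j.
rewrite -(subrKA (fv V E j ord0)) dotvDr -[X in _ + X]opprK -dotvNr opprB.
by rewrite fo oppr0 addr0.
Qed.

(** A repeated vertex would lie both on a face and strictly on the inner side of it. *)
Lemma vertex_inj E : injective (V E).
Proof.
move=> i i' ii'; apply/eqP; apply/negPn/negP => ne.
by have := normal_lt0 E i ord0; rewrite ii' normal_orth ?ltxx// eq_sym.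
Qed.

Lemma shared_sym E j E' j' : shared V E j E' j' -> shared V E' j' E j.
Proof.
move=> [ne [h1 h2]]; split; first by rewrite eq_sym.
by split=> m; [have [k] := h2 m|have [k] := h1 m]; exists k.
Qed.

Lemma shared_perm E j E' j' : shared V E j E' j' ->
  exists s : {perm 'I_n.+1}, fv V E j = fv V E' j' \o s.
Proof.
move=> [_ [/choice[f fE] _]].
have f_inj : injective f.
  move=> m m' ff; apply: (@lift_inj _ j); apply: (@vertex_inj E).
  by have := fE m; rewrite ff -fE.
by exists (perm f_inj); apply/funext => m; rewrite /= permE fE.
Qed.

Lemma shared_vertex E j E' j' i : shared V E j E' j' -> i != j ->
  exists m, V E i = fv V E' j' m.
Proof.
move=> [_ [h _]]; have [k ->|->] := unliftP j i; last by rewrite eqxx.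
by have [m] := h k; exists m.
Qed.

Lemma shared_orth E j E' j' i m : shared V E j E' j' -> i != j' ->
  dotv (nrm E j) (V E' i - fv V E j m) = 0.
Proof.
move=> /shared_sym/shared_vertex/[apply] -[k ->].
by apply: normal_orth; rewrite eq_sym neq_lift.
Qed.

(** With equal weights on a face only the sum of its vertices matters, and both adjacent elements
    have the same sum. *)
Lemma sum_face_vertices E j (l : 'I_n.+2 -> R) a :
  (forall i, i != j -> l i = a) ->
  \sum_i l i *: V E i = l j *: V E j + a *: \sum_m fv V E j m.
Proof.
move=> la; rewrite (bigD1_ord j)//= scaler_sumr; congr (_ + _).
by apply: eq_bigr => m _; rewrite la// eq_sym neq_lift.
Qed.

Context (conf : conforming V) (distV : distinct_elems V).

(* If both opposite vertices were on the same side of the common face, a point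
   close to the barycenter of the face, moved towards the vertex opposite to
   it in [E], would be in both elements, against conformity. *)
Lemma shared_opposite E j E' j' : shared V E j E' j' ->
  0 < dotv (nrm E j) (V E' j' - fv V E j ord0).
Proof.
move=> sh; set N := nrm E j; set q := fv V E j ord0; set u := V E j.
have orth' i : i != j' -> dotv N (V E' i - q) = 0 by exact: shared_orth.
have alpha_lt0 : dotv N (u - q) < 0 by exact: normal_lt0.
set beta := dotv N (V E' j' - q).
have beta_neq0 : beta != 0.
  apply/eqP => beta0.
  have all0 i : dotv N (V E' i - q) = 0.
    by have [->//|/orth'] := eqVneq i j'.
  have N0 : N = 0.
    apply: (@orthogonal_edges0 E') => i.
    by rewrite (dotv_chasles q) !all0 subrr.
  by have /esym/eqP := normal_sqr E j; rewrite -/N N0 dotv0r oner_eq0.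
rewrite lt_neqAle eq_sym beta_neq0/= leNgt; apply/negP => beta_lt0.
(* Comparing normal components, [th j'] is the quotient of the signed heights of the two opposite
   vertices, positive when these have the same sign. *)
have [th [th1 uE]] := barycentric_coordinates E' u.
have thj : dotv N (u - q) = th j' * beta.
  rewrite uE dotv_affine// (bigD1 j')//= big1 ?addr0// => i ij.
  by rewrite orth' ?mulr0.
have thj_gt0 : 0 < th j' by rewrite -(nmulr_llt0 _ beta_lt0) -thj.
(* [t] is so small that [t * th i] is at least [-1/(2k)], while the common face weight [a] is at
   least [1/(2k)]; hence the weights [l2] are nonnegative. *)
pose S := 1 + \sum_i `|th i|.
have S_ge1 : 1 <= S by rewrite lerDl sumr_ge0.
have thS i : `|th i| <= S.
  by rewrite /S (bigD1 i)//= addrCA lerDl addr_ge0// sumr_ge0.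
pose k : R := n.+1%:R; have k_ge1 : 1 <= k by rewrite ler1n.
pose t := (2 * k * S)^-1.
have kS : 1 <= k * S by rewrite mulr_ege1.
have t_gt0 : 0 < t by rewrite invr_gt0; lra.
have t_le : t <= 2^-1 by rewrite lef_pV2 ?posrE; lra.
have tS : t * S = (2 * k)^-1 by rewrite /t; field; lra.
have tth i : - (2 * k)^-1 <= t * th i.
  have : t * - th i <= t * S.
    by rewrite ler_pM2l// (le_trans _ (thS i))// -normrN ler_norm.
  by rewrite tS mulrN lerNl.
pose a := (1 - t) / k.
have a_ge : (2 * k)^-1 <= a.
  by rewrite /a invfM ler_pM2r ?invr_gt0; lra.
have ki_gt0 : 0 < (2 * k)^-1 by rewrite invr_gt0; lra.
have a_ge0 : 0 <= a := le_trans (ltW ki_gt0) a_ge.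
have ka : a *+ n.+1 = 1 - t by rewrite -mulr_natr divfK// -/k; lra.
(* [l1] and [l2] weight the same point [y] in [E] and in [E']: in [l2] the vertex [V E j] is
   expanded in its coordinates [th]. *)
pose l1 i := if i == j then t else a.
pose l2 i := (if i == j' then 0 else a) + t * th i.
pose y := \sum_i l1 i *: V E i.
have l1j : l1 j = t by rewrite /l1 eqxx.
have l1a i : i != j -> l1 i = a by rewrite /l1 => /negPf ->.
have l1_sum : \sum_i l1 i = 1.
  rewrite (bigD1_ord j)//= l1j (eq_bigr (fun=> a)).
    by rewrite sumr_const card_ord ka addrC subrK.
  by move=> m _; rewrite l1a// eq_sym neq_lift.
have y_E : conv_hull (V E) y.
  exists l1; split=> [i|//]; by rewrite /l1; case: ifP => _; rewrite ?a_ge0 ?ltW.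
have y_E' : conv_hull (V E') y.
  pose l0 i : R := if i == j' then 0 else a.
  exists l2; split; [|split].
  - move=> i; rewrite /l2; case: eqP => [->|_]; last first.
      by rewrite -(subrr (2 * k)^-1) lerD.
    by rewrite add0r mulr_ge0// ltW.
  - rewrite big_split -mulr_sumr th1 mulr1 /=.
    rewrite (bigD1_ord j')//= eqxx add0r (eq_bigr (fun=> a)).
      by rewrite sumr_const card_ord ka subrK.
    by move=> m _; rewrite eq_sym (negPf (neq_lift _ _)).
  - under eq_bigr do rewrite scalerDl -scalerA.
    rewrite big_split -scaler_sumr -uE (@sum_face_vertices E' j' _ a); last first.
      by move=> i /negPf ->.
    rewrite eqxx scale0r add0r /y (@sum_face_vertices E j l1 a)// l1j addrC.
    congr (_ *: _ + _).
    have [s ->] := shared_perm sh.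
    by rewrite [RHS](reindex_perm s).
have [ne _] := sh.
have : (conv_hull (V E) `&` conv_hull (V E')) y by split.
rewrite conf// => -[l [_ [lsum [lcom yl]]]].
(* The normal component of [y] forces the weight [t > 0] on [V E j], which is then a common vertex;
   so all vertices of [E] would belong to [E']. *)
have lj : l j = t.
  have := congr1 (fun z => dotv N (z - q)) yl.
  rewrite /y !dotv_affine// (bigD1 j)//= [in RHS](bigD1 j)//= l1j.
  rewrite !big1 ?addr0; [|by move=> i ij; rewrite normal_orth ?mulr0..].
  by move=> /mulIf ->//; rewrite lt_eqF.
have [i] := distV ne.
have [->|ij] := eqVneq i j => noti.
  by have [|i' /eqP] := lcom j; [rewrite lj gt_eqF|rewrite (negPf (noti i'))].
have [m /eqP] := shared_vertex sh ij.
by rewrite (negPf (noti _)).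
Qed.

(** Both normals are orthogonal to the common face, hence proportional. The factor is negative
    because the vertex of [E] opposite to the face lies beyond it as seen from [E']; unit length
    makes it [-1]. *)
Lemma shared_normal E j E' j' : shared V E j E' j' -> nrm E' j' = - nrm E j.
Proof.
move=> sh; have sh' := shared_sym sh.
set N := nrm E j; set N' := nrm E' j'; set q := fv V E j ord0.
have al : dotv N (V E j - q) < 0 by exact: normal_lt0.
pose c := dotv N' (V E j - q) / dotv N (V E j - q).
have c_lt0 : c < 0.
  rewrite nmulr_llt0 ?invr_lt0//; have [m qm] := sh.2.1 ord0.
  rewrite (dotv_chasles (fv V E' j' ord0)) /q qm.
  rewrite [X in _ - X](_ : _ = 0) ?subr0; first exact: shared_opposite.
  by apply: normal_orth; rewrite eq_sym neq_lift.
have N'E : N' = c *: N.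
  apply/eqP; rewrite -subr_eq0; apply/eqP.
  have all0 i : dotv (N' - c *: N) (V E i - q) = 0.
    rewrite dotvBl dotvZl; have [->|ij] := eqVneq i j.
      by rewrite /c divfK ?subrr// lt_eqF.
    rewrite normal_orth// mulr0 subr0; have [m qm] := sh.2.1 ord0.
    by rewrite /q qm; exact: (shared_orth m sh').
  apply: (@orthogonal_edges0 E) => i.
  by rewrite (dotv_chasles q) !all0 subrr.
have : dotv N' N' = 1 by exact: normal_sqr.
rewrite N'E dotvZl dotvZr (normal_sqr E j) mulr1 -expr2 => /eqP.
by rewrite sqrf_eq1 => /orP[/eqP c1|/eqP ->]; [exfalso; lra|rewrite scaleN1r].
Qed.

(** Two different neighbours would also share the face with each other, and the opposite vertex of
    the second would lie strictly on both sides of it. *)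
Lemma shared_uniq E j E1 j1 E2 j2 :
  shared V E j E1 j1 -> shared V E j E2 j2 -> (E1, j1) = (E2, j2).
Proof.
move=> sh1 sh2.
have tr m1 : exists m2, fv V E1 j1 m1 = fv V E2 j2 m2.
  have [m <-] := sh1.2.2 m1.
  by have [m2 e] := sh2.2.1 m; exists m2.
have tr' m2 : exists m1, fv V E1 j1 m1 = fv V E2 j2 m2.
  have [m <-] := sh2.2.2 m2.
  by have [m1 e] := sh1.2.1 m; exists m1.
(* Within one element, vertex [j1] lies on every other face but not on its own opposite face, so the
   two faces coincide. *)
have [eE|neE] := eqVneq E1 E2.
  subst E2; have [->//|nej] := eqVneq j1 j2.
  have [k ej|ej] := unliftP j2 j1; last by rewrite ej eqxx in nej.
  have [m1 /vertex_inj/eqP] := tr' k.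
  by rewrite -ej eq_sym (negPf (neq_lift _ _)).
have sh12 : shared V E1 j1 E2 j2 by [].
have := shared_opposite sh12; have := shared_opposite sh2.
rewrite (shared_normal sh1) dotvNl oppr_gt0.
have [m <-] := sh1.2.2 ord0; have [_ [fo _]] := nrmP E j.
rewrite (dotv_chasles (fv V E j ord0) _ _ (fv V E j m)) fo subr0.
by move=> /lt_trans/[apply]; rewrite ltxx.
Qed.

End MeshGeometry.

(** * Polynomials of degree at most [k] *)

Section BoundedDegree.
Context {R : realType} {d k : nat}.
Implicit Types f g : 'rV[R]_d -> R.

Lemma eq_is_Pk f g : f =1 g -> is_Pk k f -> is_Pk k g.
Proof. by move=> fg [c cE]; exists c => x; rewrite -fg. Qed.

Lemma is_Pk_polyfun f : is_Pk k f -> rv_polyfun f.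
Proof.
move=> [c cE]; apply: (@eq_polyfun _ _ _ _ (fun x : 'rV_d =>
    \sum_(a : {ffun 'I_d -> 'I_k.+1})
      (if (\sum_i (a i : nat) <= k)%N then c a else 0)
        * \prod_i (x 0 i) ^+ a i)).
  move=> x; rewrite cE [RHS]big_mkcond; apply: eq_bigr => a _.
  by case: ifP => // _; rewrite mul0r.
apply: polyfun_sum => a; apply/polyfunZ/polyfun_prod => i.
by apply: polyfunX; exact: polyfun_coord.
Qed.

Lemma is_Pk0 : is_Pk k (fun _ : 'rV[R]_d => 0).
Proof. by exists (fun=> 0) => x; rewrite big1// => a _; rewrite mul0r. Qed.

Lemma is_PkD f g : is_Pk k f -> is_Pk k g -> is_Pk k (fun x => f x + g x).
Proof.
move=> [c cE] [e eE]; exists (fun a => c a + e a) => x.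
by rewrite cE eE -big_split; apply: eq_bigr => a _; rewrite mulrDl.
Qed.

Lemma is_PkZ a f : is_Pk k f -> is_Pk k (fun x => a * f x).
Proof.
move=> [c cE]; exists (fun b => a * c b) => x.
by rewrite cE mulr_sumr; apply: eq_bigr => b _; rewrite mulrA.
Qed.

Lemma is_Pk_sum (I : finType) (P : pred I) (f : I -> 'rV[R]_d -> R) :
  (forall i, P i -> is_Pk k (f i)) -> is_Pk k (fun x => \sum_(i | P i) f i x).
Proof.
move=> Pkf; rewrite (_ : (fun x => _) = \sum_(i | P i) f i).
  apply: (big_ind (is_Pk k)) => //; first exact: is_Pk0.
  by move=> g h; exact: is_PkD.
by apply/funext => x; rewrite fct_sumE.
Qed.

Lemma is_Pk_monomial (b : 'I_d -> nat) : (\sum_i b i <= k)%N ->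
  is_Pk k (fun x : 'rV[R]_d => \prod_i x 0 i ^+ b i).
Proof.
move=> bk; have bi i : (b i < k.+1)%N.
  by rewrite ltnS (leq_trans _ bk)// (bigD1 i)//= leq_addr.
pose B : {ffun 'I_d -> 'I_k.+1} := [ffun i => Ordinal (bi i)].
exists (fun a => (a == B)%:R) => x.
rewrite (bigD1 B)/=.
  rewrite eqxx mul1r [X in _ + X]big1 ?addr0; last first.
    by move=> a /andP[_ /negPf ->]; rewrite mul0r.
  by apply: eq_bigr => i _; rewrite ffunE.
by rewrite (eq_bigr b)// => i _; rewrite ffunE.
Qed.

(** The bound [k] is kept, as it is the degree for which the trace inequality is assumed. *)
Lemma is_Pk_grad f i : is_Pk k f -> is_Pk k (fun x => grad f x 0 i).
Proof.
move=> [c cE].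
(* The subtraction in the exponent is truncated; when [a i = 0] the coefficient kills the term. *)
apply: (@eq_is_Pk (fun x => \sum_(a : {ffun 'I_d -> 'I_k.+1} |
    (\sum_l (a l : nat) <= k)%N) (c a * (a i)%:R) *
    \prod_l x 0 l ^+ (a l - (l == i)))).
  move=> x; rewrite mxE.
  pose p : {poly R} := \sum_(a : {ffun 'I_d -> 'I_k.+1} |
    (\sum_l (a l : nat) <= k)%N)
    (c a * \prod_(l | l != i) x 0 l ^+ a l) *: ('X + (x 0 i)%:P) ^+ a i.
  have -> : (fun t => f (x + t *: delta_mx 0 i)) = horner p.
    apply/funext => t; rewrite cE horner_sum; apply: eq_bigr => a _.
    rewrite hornerZ horner_exp hornerD hornerX hornerC (bigD1 i)//= -mulrA.
    congr (_ * _); rewrite mulrC !mxE !eqxx mulr1 (addrC t); congr (_ * _).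
    by apply: eq_bigr => l /negPf li; rewrite !mxE li andbF mulr0 addr0.
  rewrite -derivE raddf_sum horner_sum; apply: eq_bigr => a _ /=.
  rewrite derivZ hornerZ deriv_exp derivD derivX derivC addr0 mul1r hornerMn.
  rewrite horner_exp hornerD hornerX hornerC add0r (bigD1 i)//= eqxx subn1.
  rewrite (eq_bigr (fun l => x 0 l ^+ a l)).
    rewrite -(mulr_natr (x 0 i ^+ _)); set y := x 0 i ^+ _; set z := \prod_(_ | _) _.
    by move: (c a) ((a i)%:R : R) y z => C N y z; ring.
  by move=> l /negPf ->; rewrite subn0.
apply: is_Pk_sum => a ak; apply: is_PkZ; apply: is_Pk_monomial.
by apply: leq_trans ak; apply: leq_sum => l _; exact: leq_subr.
Qed.

End BoundedDegree.

(** * Integrals as positive functionals *)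

Section PositiveFunctional.
Context {R : realType} {d : nat}.
Implicit Types (I : ('rV[R]_d -> R) -> R) (f g : 'rV[R]_d -> R).

(** Linearity is asked on polynomials only. Element and face integrals both qualify, and comparing
    polynomial integrands then needs no measure theory. *)
Definition positive_functional I :=
  (forall a f g, rv_polyfun f -> rv_polyfun g ->
     I (fun x => a * f x + g x) = a * I f + I g) /\
  (forall f, (forall x, 0 <= f x) -> 0 <= I f).

Context {I : ('rV[R]_d -> R) -> R} (I_pos : positive_functional I).

Lemma functionalZ a f : rv_polyfun f -> I (fun x => a * f x) = a * I f.
Proof.
move=> pf; have p0 := @polyfun_cst R _ _ (fun i (x : 'rV[R]_d) => x 0 i) 0.
have I0 : I (fun=> 0) = 0.
  have := I_pos.1 1 _ _ p0 p0.
  rewrite (_ : (fun _ => _) = (fun=> 0)); first by lra.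
  by apply/funext => x; rewrite mulr0 addr0.
by rewrite -[RHS]addr0 -I0 -I_pos.1//; congr I; apply/funext => x; rewrite addr0.
Qed.

Lemma functional_le f g : rv_polyfun f -> rv_polyfun g ->
  (forall x, f x <= g x) -> I f <= I g.
Proof.
move=> pf pg fg; rewrite -subr_ge0 addrC -mulN1r -I_pos.1//.
by apply: I_pos.2 => x; rewrite mulN1r addrC subr_ge0.
Qed.

End PositiveFunctional.

Section MeshIntegrals.
Context {R : realType} {n nE : nat} {V : 'I_nE -> 'I_n.+2 -> 'rV[R]_n.+1}.

Lemma int_elemE E g :
  int_elem V E g = `|\det (elemB V E)| * simplex_avg (V E) g.
Proof. by []. Qed.

Lemma int_elem_functional E : positive_functional (int_elem V E).
Proof.
split=> [a f g pf pg|f f0]; rewrite !int_elemE.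
  by rewrite simplex_avg_linear//; ring.
by rewrite mulr_ge0// simplex_avg_ge0.
Qed.

Lemma int_faceE E j g :
  int_face V E j g = Num.sqrt (gram (fv V E j)) * simplex_avg (fv V E j) g.
Proof. by []. Qed.

Lemma int_face_functional E j : positive_functional (int_face V E j).
Proof.
split=> [a f g pf pg|f f0]; rewrite !int_faceE.
  by rewrite simplex_avg_linear//; ring.
by rewrite mulr_ge0// ?sqrtr_ge0// simplex_avg_ge0.
Qed.

Lemma int_face_shared nrm E j E' j' g : elems_nondegenerate V ->
  normal_spec V nrm -> shared V E j E' j' -> rv_polyfun g ->
  int_face V E j g = int_face V E' j' g.
Proof.
move=> ndV nrmP sh pg; have [s sE] := shared_perm nrmP sh.
by rewrite !int_faceE sE gram_perm simplex_avg_perm.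
Qed.

End MeshIntegrals.

(** * Coercivity *)

Section SymmetricForm.
Context {R : realType} {m : nat} {A : 'M[R]_m}.
Context (A_sym : A^T = A) (A_ge0 : forall u : 'rV_m, 0 <= dotv (u *m A) u).

Lemma dotv_symmx (u w : 'rV[R]_m) : dotv (u *m A) w = dotv (w *m A) u.
Proof.
have E (x y : 'rV[R]_m) : dotv x y = (x *m y^T) 0 0.
  by rewrite mxE; apply: eq_bigr => i _; rewrite mxE.
by rewrite [RHS]dotvC !E trmx_mul A_sym mulmxA.
Qed.

(** Expand the form at [b *: u - c *: w], with [b = dotv (w *m A) w] and [c = dotv (u *m A) w], and
    divide by [b]. *)
Lemma dotv_cauchy_schwarz (u w : 'rV[R]_m) : 0 < dotv (w *m A) w ->
  dotv (u *m A) w ^+ 2 <= dotv (w *m A) w * dotv (u *m A) u.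
Proof.
move=> b_gt0; set b := dotv (w *m A) w in b_gt0 *.
set c := dotv (u *m A) w; set g := dotv (u *m A) u.
have := A_ge0 (b *: u - c *: w).
rewrite mulmxBl -!scalemxAl dotvBl !dotvBr !dotvZl !dotvZr.
rewrite (dotv_symmx w u) -/b -/c -/g.
have -> : b * (b * g) - b * (c * c) - (c * (b * c) - c * (c * b)) =
          b * (b * g - c ^+ 2) by ring.
by rewrite pmulr_rge0// subr_ge0.
Qed.

End SymmetricForm.

Section FaceAlgebra.
Context {R : realType}.

(* Completing the square in the jump [J]; the mean and the jump of the flux
   combine so that
   [(w2 a1 - w1 a2)^2 / rho0 + rho1 (a1 + a2)^2 = a1^2 / t1 + a2^2 / t2]. *)
Lemma interior_face_bound (t1 t2 a1 a2 J : R) : 0 < t1 -> 0 < t2 ->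
  4^-1 * (t1 * t2 / (t1 + t2) * J ^+ 2) - 4 / 3 * (a1 ^+ 2 / t1 + a2 ^+ 2 / t2)
  <= t1 * t2 / (t1 + t2) * J ^+ 2
     - 2 * ((t2 / (t1 + t2) * a1 - t1 / (t1 + t2) * a2) * J)
     - (t1 + t2)^-1 * (a1 + a2) ^+ 2.
Proof.
move=> t1_gt0 t2_gt0; rewrite -subr_ge0.
have t12 : 0 < t1 + t2 by rewrite addr_gt0.
have -> : t1 * t2 / (t1 + t2) * J ^+ 2
    - 2 * ((t2 / (t1 + t2) * a1 - t1 / (t1 + t2) * a2) * J)
    - (t1 + t2)^-1 * (a1 + a2) ^+ 2
    - (4^-1 * (t1 * t2 / (t1 + t2) * J ^+ 2)
       - 4 / 3 * (a1 ^+ 2 / t1 + a2 ^+ 2 / t2)) =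
  3 / 4 * (t1 * t2 / (t1 + t2)) * (J - 4 / 3 * (a1 / t1 - a2 / t2)) ^+ 2
  + 3^-1 * (t1 + t2)^-1 * (a1 + a2) ^+ 2.
  by field; rewrite !gt_eqF.
by rewrite addr_ge0// mulr_ge0 ?sqr_ge0// mulr_ge0// ?divr_ge0 ?invr_ge0 ?mulr_ge0// ltW.
Qed.

(** Three quarters of the penalty complete the square in [J], at the cost of [4/3] of the flux
    term. *)
Lemma boundary_face_bound (t a J : R) : 0 < t ->
  4^-1 * (t * J ^+ 2) - 4 / 3 * (a ^+ 2 / t) <= t * J ^+ 2 - 2 * (a * J).
Proof.
move=> t_gt0; rewrite -subr_ge0.
have -> : t * J ^+ 2 - 2 * (a * J)
    - (4^-1 * (t * J ^+ 2) - 4 / 3 * (a ^+ 2 / t)) =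
    3 / 4 * t * (J - 4 / 3 * (a / t)) ^+ 2.
  by field; rewrite gt_eqF.
by rewrite mulr_ge0 ?sqr_ge0// mulr_ge0// ltW.
Qed.

End FaceAlgebra.

(** * Summation over faces and over element sides *)

Section FaceSum.
Context {R : realType} {n nE : nat}.
Context {nb : 'I_nE -> 'I_n.+2 -> option ('I_nE * 'I_n.+2)}.
Implicit Types G H : 'I_nE -> 'I_n.+2 -> R.

Lemma face_sum_ge0 G : (forall E j, 0 <= G E j) -> 0 <= face_sum nb G.
Proof.
move=> G0; apply: sumr_ge0 => E _; apply: sumr_ge0 => j _.
by apply: mulr_ge0 => //; case: nb => *; rewrite ?invr_ge0.
Qed.

Lemma face_sumD G H :
  face_sum nb (fun E j => G E j + H E j) = face_sum nb G + face_sum nb H.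
Proof.
rewrite -big_split; apply: eq_bigr => E _ /=.
by rewrite -big_split; apply: eq_bigr => j _; rewrite mulrDr.
Qed.

Lemma face_sumZ a G : face_sum nb (fun E j => a * G E j) = a * face_sum nb G.
Proof.
rewrite mulr_sumr; apply: eq_bigr => E _.
by rewrite mulr_sumr; apply: eq_bigr => j _; rewrite mulrCA.
Qed.

(** An interior face is visited from both elements with weight [1/2], each time collecting both
    sides, so every element side counts once. *)
Lemma face_sum_sides G :
  (forall E j E' j', nb E j = Some (E', j') -> nb E' j' = Some (E, j)) ->
  face_sum nb (fun E j =>
    G E j + (if nb E j is Some (E', j') then G E' j' else 0)) =
  \sum_E \sum_j G E j.
Proof.
move=> nbK; rewrite /face_sum !pair_bigA /=.
(* [h] exchanges the two sides of an interior face and fixes the boundary sides. *)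
pose h (p : 'I_nE * 'I_n.+2) := odflt p (nb p.1 p.2).
have hK : involutive h.
  move=> [E j]; rewrite /h /=; case e : (nb E j) => [[E' j']|] /=.
    by rewrite (nbK _ _ _ _ e).
  by rewrite e.
pose inner (p : 'I_nE * 'I_n.+2) := isSome (nb p.1 p.2).
have hin p : inner (h p) = inner p.
  case: p => E j; rewrite /inner /h /=; case e : (nb E j) => [[E' j']|] /=.
    by rewrite (nbK _ _ _ _ e).
  by rewrite e.
have sides : \sum_(p | inner p) G (h p).1 (h p).2 = \sum_(p | inner p) G p.1 p.2.
  by rewrite [RHS](reindex_inj (inv_inj hK)); apply: eq_bigl => p; rewrite hin.
transitivity (\sum_p (if inner p then 2^-1 else 1) * G p.1 p.2 +
              2^-1 * \sum_(p | inner p) G (h p).1 (h p).2).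
  rewrite [X in 2^-1 * X]big_mkcond mulr_sumr -big_split.
  apply: eq_bigr => -[E j] _; rewrite /inner /h /=.
  by case: (nb E j) => [[E' j']|] /=; ring.
rewrite sides [X in 2^-1 * X]big_mkcond mulr_sumr -big_split.
by apply: eq_bigr => p _ /=; case: (inner p); [field|ring].
Qed.

End FaceSum.

Section Coercivity.
Context {R : realType} {n nE : nat} {V : 'I_nE -> 'I_n.+2 -> 'rV[R]_n.+1}.
Context {nb : 'I_nE -> 'I_n.+2 -> option ('I_nE * 'I_n.+2)}.
Context {nrm : 'I_nE -> 'I_n.+2 -> 'rV[R]_n.+1} {K : 'I_nE -> 'M[R]_n.+1}.
Context {kmin kmax alpha0 CT : R} {k : nat} {v : 'I_nE -> 'rV[R]_n.+1 -> R}.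
Context (ndV : elems_nondegenerate V) (distV : distinct_elems V).
Context (conf : conforming V) (nbP : neighbour_spec V nb).
Context (nrmP : normal_spec V nrm) (KP : kappa_spec K kmin kmax).
Context (alpha0_gt0 : 0 < alpha0) (traceP : trace_const V k CT).
Context (vP : forall E, is_Pk k (v E)).
Implicit Types (E : 'I_nE) (j : 'I_n.+2).

Lemma neighbour_sym E j E' j' : nb E j = Some (E', j') -> nb E' j' = Some (E, j).
Proof.
move=> nbE; have := nbP E j; rewrite nbE => /shared_sym sh.
have := nbP E' j'; case: (nb E' j') => [[E2 j2] sh2|/(_ _ _ sh)//].
by rewrite (shared_uniq ndV nrmP conf distV sh sh2).
Qed.

Lemma kappa_sym E : (K E)^T = K E.
Proof. by case: KP => _ [_ /(_ E)[]]. Qed.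

Lemma kappa_ge0 E (x : 'rV_n.+1) : 0 <= dotv (x *m K E) x.
Proof.
have [kmin0 [_ /(_ E)[_ /(_ x)[lb _]]]] := KP.
by rewrite (le_trans _ lb)// mulr_ge0 ?dotv_ge0// ltW.
Qed.

Lemma kEF_gt0 E j : 0 < kEF nrm K E j.
Proof.
have [kmin0 [_ /(_ E)[_ /(_ (nrm E j))[lb _]]]] := KP.
by rewrite (lt_le_trans _ lb)// (normal_sqr nrmP) mulr1.
Qed.

Lemma diam_gt0 E : 0 < diam V E.
Proof.
have [i w0] : exists i, enorm (V E ord0 - V E i) != 0.
  exists (lift ord0 ord0); rewrite gt_eqF// sqrtr_gt0 lt_neqAle dotv_ge0 andbT.
  rewrite eq_sym; apply/eqP => /dotvv_eq0 w0.
  by have := normal_lt0 nrmP E ord0 ord0; rewrite /fv w0 dotv0r ltxx.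
rewrite (@lt_le_trans _ _ (enorm (V E ord0 - V E i)))//.
  by rewrite lt_neqAle eq_sym w0 sqrtr_ge0.
rewrite /diam (le_trans _ (le_bigmax _ _ ord0))//.
exact: (le_bigmax _ (fun i' => enorm (V E ord0 - V E i'))).
Qed.

Let t E j := tau V nrm K alpha0 CT E j.
Let nflux E j x := dotv (flux K v E x) (nrm E j).
Let edens E x := dotv (flux K v E x) (grad (v E) x).
Let side E j := int_face V E j (fun x => nflux E j x ^+ 2 / t E j).

Lemma tau_gt0 E j : 0 < t E j.
Proof.
have [CT0 _] := traceP.
by rewrite /t /tau divr_gt0 ?diam_gt0// !mulr_gt0 ?kEF_gt0 ?exprn_gt0.
Qed.

(** The coefficient [K E] is constant on the element, so the degree does not grow. *)
Lemma flux_is_Pk E i : is_Pk k (fun x => flux K v E x 0 i).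
Proof.
apply: (@eq_is_Pk _ _ _ (fun x => \sum_l (K E)^T l i * grad (v E) x 0 l)).
  by move=> x; rewrite [RHS]mxE; apply: eq_bigr => l _; rewrite mulrC.
by apply: is_Pk_sum => l _; apply: is_PkZ; exact: is_Pk_grad.
Qed.

Lemma flux_dot_is_Pk E u : is_Pk k (fun x => dotv (flux K v E x) u).
Proof.
apply: is_Pk_sum => i _; apply: eq_is_Pk (is_PkZ (u 0 i) (flux_is_Pk E i)) => x.
by rewrite mulrC.
Qed.

Lemma edens_polyfun E : rv_polyfun (edens E).
Proof.
apply: polyfun_sum => i; apply: polyfunM.
  exact/is_Pk_polyfun/flux_is_Pk.
exact/is_Pk_polyfun/is_Pk_grad.
Qed.

Lemma v_polyfun E : rv_polyfun (v E).
Proof. exact: is_Pk_polyfun. Qed.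

Lemma nflux_polyfun E j : rv_polyfun (nflux E j).
Proof. exact/is_Pk_polyfun/flux_dot_is_Pk. Qed.

Lemma edens_ge0 E x : 0 <= edens E x.
Proof. by rewrite /edens /flux kappa_sym kappa_ge0. Qed.

Lemma side_le E j : side E j <= alpha0^-1 * int_elem V E (edens E).
Proof.
have [CT0 trP] := traceP.
have pn : rv_polyfun (fun x => nflux E j x ^+ 2) by exact/polyfunX/nflux_polyfun.
have -> : side E j = (t E j)^-1 * int_face V E j (fun x => nflux E j x ^+ 2).
  rewrite -(functionalZ (int_face_functional E j))//.
  by congr int_face; apply/funext => x; rewrite mulrC.
have h1 := trP E j _ (flux_dot_is_Pk E (nrm E j)).
(* Cauchy-Schwarz against the normal, on which the quadratic form of [K E] is [kEF]. *)
have h2 : int_elem V E (fun x => nflux E j x ^+ 2) <=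
          kEF nrm K E j * int_elem V E (edens E).
  rewrite -(functionalZ (int_elem_functional E))//; last exact: edens_polyfun.
  apply: (functional_le (int_elem_functional E)) => //.
    by apply: polyfunZ; exact: edens_polyfun.
  move=> x; rewrite /nflux /edens /flux kappa_sym.
  by apply: dotv_cauchy_schwarz; [exact: kappa_sym|exact: kappa_ge0|exact: kEF_gt0].
have h3 : int_face V E j (fun x => nflux E j x ^+ 2) <=
    CT ^+ 2 / diam V E * (kEF nrm K E j * int_elem V E (edens E)).
  by rewrite (le_trans h1)// ler_wpM2l// divr_ge0 ?sqr_ge0// ltW// diam_gt0.
rewrite -(ler_pM2l (tau_gt0 E j)) mulVKf ?gt_eqF ?tau_gt0// (le_trans h3)//.
(* [CT ^+ 2], [kEF] and [diam] cancel against [tau], leaving [alpha0^-1]. *)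
rewrite le_eqVlt; apply/orP; left; apply/eqP; rewrite /t /tau.
by field; rewrite !gt_eqF// diam_gt0.
Qed.

Lemma sum_side_le :
  \sum_E \sum_j side E j <= eta0 n / alpha0 * vol_form V K v v.
Proof.
rewrite /vol_form mulr_sumr; apply: ler_sum => E _.
apply: (le_trans (ler_sum _ (fun j _ => side_le E j))).
by rewrite sumr_const card_ord -mulr_natl mulrA /eta0 lexx.
Qed.

Let jpen E j := int_face V E j (fun x => rho0 V nb nrm K alpha0 CT E j *
  dotv (jump nb nrm v E j x) (jump nb nrm v E j x)).
Let mjump E j := int_face V E j (fun x =>
  dotv (wmean V nb nrm K alpha0 CT v E j x) (jump nb nrm v E j x)).
Let fpen E j := if nb E j is Some _ then
  int_face V E j (fun x => rho1 V nb nrm K alpha0 CT E j *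
    flux_jump nb nrm K v E j x * flux_jump nb nrm K v E j x) else 0.

Lemma rho0_ge0 E j : 0 <= rho0 V nb nrm K alpha0 CT E j.
Proof.
have t_ge0 E' j' : 0 <= tau V nrm K alpha0 CT E' j' by exact/ltW/tau_gt0.
rewrite /rho0; case: (nb E j) => [[E' j']|]; last exact: t_ge0.
by apply: divr_ge0; [apply: mulr_ge0|apply: addr_ge0]; exact: t_ge0.
Qed.

Lemma jpen_ge0 E j : 0 <= jpen E j.
Proof.
apply: (int_face_functional E j).2 => x.
by rewrite mulr_ge0 ?dotv_ge0// rho0_ge0.
Qed.

Lemma fpen_ge0 E j : 0 <= fpen E j.
Proof.
rewrite /fpen /rho1; case: (nb E j) => [[E' j']|]//.
apply: (int_face_functional E j).2 => x.
rewrite -mulrA -expr2; apply: mulr_ge0; last exact: sqr_ge0.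
by rewrite invr_ge0; apply: addr_ge0; exact/ltW/tau_gt0.
Qed.

(** The pointwise face inequalities, integrated and arranged as a linear combination over which
    [face_sumD] and [face_sumZ] distribute. *)
Lemma face_bound E j :
  0 <= 3 / 4 * jpen E j + -2 * mjump E j + -1 * fpen E j + 4 / 3 *
    (side E j + (if nb E j is Some (E', j') then side E' j' else 0)).
Proof.
suff : 4^-1 * jpen E j
    - 4 / 3 * (side E j + (if nb E j is Some (E', j') then side E' j' else 0))
  <= jpen E j - 2 * mjump E j - fpen E j by lra.
pose I := int_face V E j.
have If : positive_functional I := int_face_functional E j.
have N1 := normal_sqr nrmP E j.
rewrite /fpen /jpen /mjump /jump /rho0 /wmean /rho1 /flux_jump.
have := nbP E j; case: (nb E j) => [[E' j'] sh|_]; last first.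
  pose f x := t E j * v E x ^+ 2.
  pose g x := nflux E j x * v E x.
  pose s x := nflux E j x ^+ 2 / t E j.
  have pf : rv_polyfun f by apply/polyfunZ/polyfunX/v_polyfun.
  have pg : rv_polyfun g.
    by apply: polyfunM; [exact: nflux_polyfun|exact: v_polyfun].
  have ps : rv_polyfun s.
    by apply: polyfunM; [exact/polyfunX/nflux_polyfun|exact: polyfun_cst].
  rewrite (_ : (fun x => _ * _) = f); last first.
    by apply/funext => x; rewrite dotvZl dotvZr N1 mulr1 -expr2.
  rewrite (_ : (fun x => _) = g); last first.
    by apply/funext => x; rewrite dotvZr mulrC.
  rewrite /side -/I -/s addr0 subr0.
  have -> : 4^-1 * I f - 4 / 3 * I s = I (fun x => 4^-1 * f x + (- (4 / 3)) * s x).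
    by rewrite (If.1 _ _ _ pf (polyfunZ _ ps)) (functionalZ If _ ps) mulNr.
  have -> : I f - 2 * I g = I (fun x => (- 2) * g x + f x).
    by rewrite (If.1 _ _ _ pg pf) mulNr addrC.
  apply: (functional_le If) => [||x].
  - by apply: polyfunD; exact: polyfunZ.
  - by apply: polyfunD => //; exact: polyfunZ.
  - rewrite mulNr [leRHS]addrC mulNr.
    by apply: boundary_face_bound; exact: tau_gt0.
have N'E := shared_normal ndV nrmP conf distV sh.
set t1 := tau _ _ _ _ _ E j; set t2 := tau _ _ _ _ _ E' j'.
pose J x := v E x - v E' x.
pose f x := t1 * t2 / (t1 + t2) * J x ^+ 2.
pose g x := (t2 / (t1 + t2) * nflux E j x - t1 / (t1 + t2) * nflux E' j' x) * J x.
pose h x := (t1 + t2)^-1 * (nflux E j x + nflux E' j' x) ^+ 2.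
pose s1 x := nflux E j x ^+ 2 / t1.
pose s2 x := nflux E' j' x ^+ 2 / t2.
have pn1 := nflux_polyfun E j; have pn2 := nflux_polyfun E' j'.
have pJ : rv_polyfun J by apply: polyfunB; exact: v_polyfun.
have pf : rv_polyfun f by apply/polyfunZ/polyfunX.
have pg : rv_polyfun g.
  by apply: polyfunM => //; apply: polyfunB; exact: polyfunZ.
have ph : rv_polyfun h by apply/polyfunZ/polyfunX/polyfunD.
have ps1 : rv_polyfun s1 by apply: polyfunM; [exact: polyfunX|exact: polyfun_cst].
have ps2 : rv_polyfun s2 by apply: polyfunM; [exact: polyfunX|exact: polyfun_cst].
(* Opposite normals turn the vector jump into the scalar [J] along [nrm E j], and the weighted mean
   of the fluxes into the difference in [g]. *)
have jumpE x : v E x *: nrm E j + v E' x *: nrm E' j' = J x *: nrm E j.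
  by rewrite N'E scalerN -scalerBl.
rewrite (_ : (fun x => _ * dotv _ _) = f); last first.
  by apply/funext => x; rewrite jumpE dotvZl dotvZr N1 mulr1 -expr2.
rewrite (_ : (fun x => dotv _ _) = g); last first.
  apply/funext => x; rewrite jumpE dotvZr mulrC dotvDl !dotvZl; congr (_ * _).
  by rewrite /nflux N'E dotvNr mulrN opprK.
rewrite (_ : (fun x => _ * _ * _) = h); last first.
  by apply/funext => x; rewrite -mulrA -expr2.
(* The neighbour's term, integrated in its own parametrization, is transported to that of [E]. *)
rewrite /side -(int_face_shared ndV nrmP sh ps2) -/I -/s1 -/s2.
have -> : 4^-1 * I f - 4 / 3 * (I s1 + I s2) =
    I (fun x => 4^-1 * f x + (- (4 / 3) * s1 x + - (4 / 3) * s2 x)).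
  have pZ2 := polyfunZ (- (4 / 3)) ps2.
  rewrite (If.1 _ _ _ pf (polyfunD (polyfunZ _ ps1) pZ2)) (If.1 _ _ _ ps1 pZ2).
  by rewrite (functionalZ If _ ps2); ring.
have -> : I f - 2 * I g - I h = I (fun x => - 2 * g x + (- 1 * h x + f x)).
  rewrite (If.1 _ _ _ pg (polyfunD (polyfunZ _ ph) pf)) (If.1 _ _ _ ph pf).
  by ring.
apply: (functional_le If) => [||x].
- apply: polyfunD; first exact: polyfunZ.
  by apply: polyfunD; exact: polyfunZ.
- by apply: polyfunD; [exact: polyfunZ|apply: polyfunD => //; exact: polyfunZ].
- have := @interior_face_bound R t1 t2 (nflux E j x) (nflux E' j' x) (J x)
    (tau_gt0 E j) (tau_gt0 E' j').
  rewrite -/(f x) -/(g x) -/(h x) -/(s1 x) -/(s2 x); lra.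
Qed.

(** The side terms cost at most [4/3 * 1/2 = 2/3] of the volume energy. This leaves [1/3] of it and
    [1/4] of the jump penalty, hence the constant [1/4]. *)
Lemma coercivity eps : eta0 n / alpha0 < 2^-1 ->
  eps = -1 \/ eps = 0 \/ eps = 1 ->
  4^-1 * energy_norm2 V nb nrm K alpha0 CT v <= a_h V nb nrm K alpha0 CT eps v v.
Proof.
move=> etaP epsP.
have vol_ge0 : 0 <= vol_form V K v v.
  apply: sumr_ge0 => E _; apply: (int_elem_functional E).2 => x.
  exact: edens_ge0.
have J_ge0 : 0 <= face_sum nb jpen by apply: face_sum_ge0; exact: jpen_ge0.
have S_ge0 : 0 <= face_sum nb fpen by apply: face_sum_ge0; exact: fpen_ge0.
have T_le := sum_side_le.
rewrite -(face_sum_sides side neighbour_sym) in T_le.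
have := face_sum_ge0 (nb := nb) face_bound.
rewrite !face_sumD !face_sumZ => key.
set T := face_sum nb _ in T_le; rewrite -/T in key.
have volC : eta0 n / alpha0 * vol_form V K v v <= 2^-1 * vol_form V K v v.
  by rewrite ler_wpM2r// ltW.
rewrite /energy_norm2 /a_h /ac_form /s_form /jump_seminorm2.
rewrite -/jpen -/mjump -/fpen.
(* For [eps = -1] the consistency terms cancel and the flux penalty has the good sign; half of [key]
   suffices for [eps = 0], and all of it for [eps = 1]. *)
by case: epsP => [->|[->|->]]; lra.
Qed.

End Coercivity.

Unset Implicit Arguments.

Theorem mainTheorem8 (R : realType) (C0 : R) :
  0 < C0 -> C0 ^+ 2 < 2^-1 ->
  exists Csta : R, 0 < Csta /\
  forall (n nE : nat) (Omega : set 'rV[R]_n.+1)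
         (V : 'I_nE -> 'I_n.+2 -> 'rV[R]_n.+1)
         (nb : 'I_nE -> 'I_n.+2 -> option ('I_nE * 'I_n.+2))
         (nrm : 'I_nE -> 'I_n.+2 -> 'rV[R]_n.+1)
         (K : 'I_nE -> 'M[R]_n.+1) (kmin kmax : R)
         (k : nat) (alpha0 CT eps : R),
    (n = 1 \/ n = 2)%N ->
    lipschitz_domain Omega ->
    elems_nondegenerate V -> distinct_elems V -> conforming V -> covers V Omega ->
    (forall E, diam V E <= 1) ->
    neighbour_spec V nb -> normal_spec V nrm ->
    kappa_spec K kmin kmax ->
    (1 <= k)%N ->
    0 < alpha0 -> eta0 n / alpha0 = C0 ^+ 2 ->
    trace_const V k CT ->
    (eps = -1 \/ eps = 0 \/ eps = 1) ->
    forall v : 'I_nE -> 'rV[R]_n.+1 -> R,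
      (forall E, is_Pk k (v E)) ->
      Csta * energy_norm2 V nb nrm K alpha0 CT v
        <= a_h V nb nrm K alpha0 CT eps v v.
Proof.
(* The witness is absolute: [C0] enters only through [C0 ^+ 2 < 2^-1]. *)
move=> _ C0_lt; exists 4^-1; split=> // n nE Omega V nb nrm K kmin kmax k.
move=> alpha0 CT eps _ _ ndV distV conf _ _ nbP nrmP KP _ alpha0_gt0 etaE traceP.
move=> epsP v vP.
by apply: (coercivity ndV distV conf nbP nrmP KP alpha0_gt0 traceP vP _ epsP);
  rewrite etaE.
Qed.
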